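(* Assume that $\{\lambda_t\}_{t=0}^{\infty}\subset(\kappa,1-\kappa)$ and that a sequence $\{x_t\}_{t=0}^{\infty}\subset C$ satisfies $x_{t+1}\in(1-\lambda_t)x_t+\lambda_tT(x_t)$ for each integer $t\ge 0$. Then there exist $x_*=\lim_{t\to\infty}x_t$ and a natural number $t_0$ such that for each integer $t\ge t_0$, $\phi(x_t)\subset\phi(x_* )$, and if an integer $i\in\phi(x_t)$ satisfies $x_{t+1}=\lambda_tT_i(x_t)+(1-\lambda_t)x_t$, then $T_i(x_* )=x_*$.
   Context: Let $(X,\|\cdot\|)$ be a normed space with metric $\rho(x,y)=\|x-y\|$, let $C\subset X$ be a nonempty closed convex set, fix $\theta\in C$, and fix $\kappa\in(0,1/2)$. For $x\in X$ and $r>0$ put $B(x,r)=\{y\in X:\|x-y\|\le r\}$. For an operator $S:C\to C$ put $\mathrm{Fix}(S)=\{x\in C: S(x)=x\}$. Let $m$ be a natural number, let $T_i:C\to C$, $i=1,\dots,m$, be continuous operators, and let $\phi:X\to 2^{\{1,\dots,m\}}\setminus\{\emptyset\}$ assign to each point $x \in X$ a nonempty subset $\phi(x)\subset\{1,\dots,m\}$. The following standing assumptions hold. (A1) For each $M>0$ the set $B(\theta,M)\cap C$ is compact. (A2) For every $i\in\{1,\dots,m\}$, every $z\in\mathrm{Fix}(T_i)$, every $x\in C$ and every $y\in C\setminus\mathrm{Fix}(T_i)$, we have $\|z-T_i(x)\|\le\|z-x\|$ and $\|z-T_i(y)\|<\|z-y\|$. (A3) For each $x\in C$ there exists $\delta>0$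 such that for each $y\in B(x,\delta)\cap C$, $\phi(y)\subset\phi(x)$. For $x\in C$ define the set $T(x)=\{T_i(x): i\in\phi(x)\}$; for a real number $\lambda$, $(1-\lambda)x+\lambda T(x)$ denotes the set $\{(1-\lambda)x+\lambda y: y\in T(x)\}$. Put $\bar F(T)=\{z\in C: T_i(z)=z,\ i=1,\dots,m\}$; it is assumed that $\bar F(T)\neq\emptyset$. *)

(* Defs.v *)
From HB Require Import structures.
From mathcomp Require Import all_boot all_order all_algebra.
From mathcomp Require Import all_classical all_reals all_analysis.
Import Order.TTheory GRing.Theory Num.Theory.
Import numFieldNormedType.Exports.

Set Implicit Arguments.
Unset Strict Implicit.
Unset Printing Implicit Defensive.

Local Open Scope classical_set_scope.
Local Open Scope ring_scope.

(* The index set {1, ..., m} is rendered as 'I_m, and an operator C -> C as a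
   function X -> X mapping C into C; its values off C are never used. *)
Section common_fixed_points.
Context {R : realType} {X : normedModType R}.
Implicit Types (C : set X) (S : X -> X) (x : X) (r l : R).

(* The library's closed_ball is the closure of the open ball; closed_ball_ is
   literally {y | `|x - y| <= r}. *)
Definition cball x r : set X := closed_ball_ (fun y : X => `|y|) x r.

Definition Fix C S : set X := [set x | C x /\ S x = x].

Context {m : nat}.
Implicit Types (T : 'I_m -> X -> X) (phi : X -> {set 'I_m}).

Definition bounded_parts_compact (theta : X) C : Prop :=
  forall M : R, 0 < M -> compact (cball theta M `&` C).

Definition paracontracting C T : Prop :=
  forall (i : 'I_m) (z : X), Fix C (T i) z ->
    (forall x, C x -> `|z - T i x| <= `|z - x|) /\
    (forall y, (C `\` Fix C (T i)) y -> `|z - T i y| < `|z - y|).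

Definition locally_sub C phi : Prop :=
  forall x, C x ->
    exists2 delta : R, 0 < delta &
      forall y, (cball x delta `&` C) y -> phi y \subset phi x.

Definition multi T phi x : set X := [set T i x | i in [set` phi x]].

Definition relaxed T phi l x : set X :=
  [set (1 - l) *: x + l *: y | y in multi T phi x].

Definition common_Fix C T : set X := [set z | C z /\ forall i, T i z = z].

End common_fixed_points.

(* Main.v *)
(* Distances to a common fixed point [z] decrease along the sequence, so their
   decrements tend to 0.  Take a cluster point [p].  An index [i] with
   [T i p != p] used close to [p] would decrease the distance to [z] by a fixed
   amount, so this happens only finitely often; hence, close to [p] and for large
   times, only operators fixing [p] are used and the distance to [p] cannot
   increase.  As the sequence comes arbitrarily close to [p], it converges to it. *)

Require Import Defs.
From HB Require Import structures.
From mathcomp Require Import all_boot all_order all_algebra.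
From mathcomp Require Import all_classical all_reals all_analysis.
From mathcomp Require Import lra.
Import Order.TTheory GRing.Theory Num.Theory.
Import numFieldNormedType.Exports.

Set Implicit Arguments.
Unset Strict Implicit.
Unset Printing Implicit Defensive.

Local Open Scope classical_set_scope.
Local Open Scope ring_scope.

(** Convexity of the norm, arranged to display the decrease: [l] times the gain of [v] over [u]. A
    nonnegative gain yields monotonicity, a gain bounded below a definite drop. *)
Lemma norm_relaxed_le (R : realType) (X : normedModType R) (l : R) (z u v : X) :
  0 <= l <= 1 ->
  `|z - ((1 - l) *: u + l *: v)| <= `|z - u| - l * (`|z - u| - `|z - v|).
Proof.
move=> /andP[l0 l1].
have -> : z - ((1 - l) *: u + l *: v) = (1 - l) *: (z - u) + l *: (z - v).
  by rewrite !scalerBr addrACA -scalerDl subrK scale1r -opprD.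
apply: (le_trans (ler_normD _ _)).
by rewrite !normrZ ger0_norm ?subr_ge0// (ger0_norm l0); lra.
Qed.

Lemma nonincreasing_gap_near (R : realType) (d : nat -> R) (e : R) :
  nonincreasing_seq d -> (forall t, 0 <= d t) -> 0 < e ->
  \forall t \near \oo, d t - d t.+1 < e.
Proof.
move=> d_dec d_ge0 e_gt0.
have d_cvg : cvgn d.
  by apply: nonincreasing_is_cvgn => //; exists 0 => _ [t _ <-].
have dS_cvg : d t.+1 @[t --> \oo] --> limn d by rewrite cvg_shiftS.
have gap0 : d t - d t.+1 @[t --> \oo] --> 0.
  by rewrite -(subrr (limn d)); exact: cvgB.
exact: (cvgr_lt _ gap0 _ e_gt0).
Qed.

(** A trapping argument: near [p] and at late times a step cannot increase the distance to [p], so a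
    small ball around [p], once entered late, is never left. The equation [x t = y] lets a product
    filter express that [t] is large and [x t] is close to [p]. *)
Lemma locally_fejer_cvg (R : realType) (X : normedModType R) (x : nat -> X)
    (p : X) :
  cluster (x @ \oo) p ->
  (\forall y \near p & t \near \oo, x t = y -> `|p - x t.+1| <= `|p - x t|) ->
  x @ \oo --> p.
Proof.
move=> clp [[U V] /= [/nbhs_ballP[dl /= dl0 dlU] [t0 _ t0V]] UV].
apply/cvgrPdist_lt => e e0.
(* This radius gives the required accuracy [e] and keeps the points within the ball of radius [dl]
   where the monotonicity hypothesis applies. *)
have r0 : 0 < Num.min e dl by rewrite lt_min e0.
have tail : (x @ \oo) [set x t | t in [set t | (t0 <= t)%N]].
  by exists t0 => // t /= tt0; exists t.
have [_ [[t1 /= t01 <-] near1]] := clp _ _ tail (nbhsx_ballx p _ r0).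
have near_p t : (t1 <= t)%N -> `|p - x t| < Num.min e dl.
  elim: t => [|t IH]; first by rewrite leqn0 => /eqP <-; rewrite -ball_normE in near1.
  rewrite leq_eqVlt => /orP[/eqP<-|]; first by rewrite -ball_normE in near1.
  rewrite ltnS => t1t; have xt := IH t1t; apply: le_lt_trans (xt).
  apply: (UV (x t, t)) => //; split => /=.
    by apply: dlU; rewrite -ball_normE /=; move: xt; rewrite lt_min => /andP[].
  by apply: t0V => /=; apply: leq_trans t1t.
by exists t1 => // t /= /near_p; rewrite lt_min => /andP[].
Qed.

Theorem theorem6p2 (R : realType) (X : normedModType R) (C : set X)
  (theta : X) (kappa : R) (m : nat) (T : 'I_m -> X -> X)
  (phi : X -> {set 'I_m}) (lambda : nat -> R) (x : nat -> X)
  (C_neq0 : C !=set0) (C_closed : closed C) (C_convex : convex_set C)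
  (theta_in : C theta) (kappa_gt0 : 0 < kappa) (kappa_lt : kappa < 1 / 2)
  (T_maps : forall i, set_fun C C (T i))
  (T_cont : forall i, {within C, continuous (T i)})
  (phi_neq0 : forall y, phi y != finset.set0)
  (A1 : bounded_parts_compact theta C)
  (A2 : paracontracting C T)
  (A3 : locally_sub C phi)
  (F_neq0 : common_Fix C T !=set0)
  (lambda_in : forall t, kappa < lambda t < 1 - kappa)
  (x_in : forall t, C (x t))
  (x_step : forall t, relaxed T phi (lambda t) (x t) (x t.+1)) :
  exists2 xstar : X, C xstar /\ x @ \oo --> xstar &
    exists t0 : nat, forall t : nat, (t0 <= t)%N ->
      phi (x t) \subset phi xstar /\
      (forall i : 'I_m, i \in phi (x t) ->
         x t.+1 = lambda t *: T i (x t) + (1 - lambda t) *: x t ->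
         T i xstar = xstar).
Proof.
have [z [Cz Tz]] := F_neq0.
have lam01 t : 0 <= lambda t <= 1.
  by move: (lambda_in t) => /andP[? ?]; apply/andP; split; lra.
(* Stated for an arbitrary fixed point [w] of [T i], because it serves first for [z] and later for
   [p]. *)
have step_le w i t : C w -> T i w = w ->
    x t.+1 = (1 - lambda t) *: x t + lambda t *: T i (x t) ->
    `|w - x t.+1| <= `|w - x t|.
  move=> Cw Tw ->; apply: (le_trans (norm_relaxed_le _ _ _ (lam01 t))).
  have /andP[l0 _] := lam01 t.
  have [nonexp _] := A2 i _ (conj Cw Tw : Fix C (T i) w).
  by rewrite gerBl mulr_ge0// subr_ge0 nonexp.
have dist_dec : nonincreasing_seq (fun t => `|z - x t|).
  apply/nonincreasing_seqP => t.
  have [_ [i _ <-] /esym xS] := x_step t.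
  exact: step_le Cz (Tz i) xS.
(* The radius bounds the distance from [theta] to [x t] through [z]; the summand 1 only makes it
   positive. *)
have [p [[_ Cp] clp]] : (cball theta (`|theta - z| + `|z - x 0%N| + 1) `&` C)
    `&` cluster (x @ \oo) !=set0.
  apply: A1; first by rewrite ltr_wpDl// addr_ge0.
  exists 0%N => // t _ /=; split => //.
  rewrite /cball /closed_ball_ /=.
  have := ler_distD z theta (x t).
  have := dist_dec 0%N t isT; lra.
have fixes_p_i i : \forall y \near p & t \near \oo, x t = y ->
    x t.+1 = (1 - lambda t) *: x t + lambda t *: T i (x t) -> T i p = p.
  (* If [T i] moves [p], the premises are shown to be contradictory for [y] near [p] and [t]
     large. *)
  have [Tp|Tp] := pselect (T i p = p); first by apply: filterE => -[y t].
  have [_ /(_ p) drop] := A2 i _ (conj Cz (Tz i) : Fix C (T i) z).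
  have {}drop : 0 < `|z - p| - `|z - T i p|.
    by rewrite subr_gt0; apply: drop; split => // -[].
  set g := `|z - p| - `|z - T i p| in drop.
  (* Continuity of [T i] is known only within [C], hence the restricted filter here and the premise
     [C y] in [near_y]. *)
  have g_cvg : `|z - y| - `|z - T i y| @[y --> within C (nbhs p)] --> g.
    apply: cvgB; apply: cvg_norm; apply: cvgB; try exact: cvg_cst.
      exact: cvg_within.
    by move: (T_cont i) => /subspace_continuousP; apply.
  have g2 : g / 2 < g by lra.
  have near_y : \forall y \near p, C y -> g / 2 < `|z - y| - `|z - T i y|.
    exact: (cvgr_gt _ g_cvg _ g2).
  (* Since [lambda t] exceeds [kappa], a step using [i] where the gain exceeds [g / 2] would lower
     the distance to [z] by at least this threshold. *)
  have near_t : \forall t \near \oo,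
      `|z - x t| - `|z - x t.+1| < kappa * (g / 2).
    by apply: (nonincreasing_gap_near dist_dec) => //; rewrite mulr_gt0// divr_gt0.
  exists ([set y | C y -> g / 2 < `|z - y| - `|z - T i y|],
    [set t | `|z - x t| - `|z - x t.+1| < kappa * (g / 2)]); first by split.
  move=> [y t] /= [yP tP] xty xS; exfalso; move: yP tP.
  rewrite -xty => /(_ (x_in t)) yP.
  have := norm_relaxed_le z (x t) (T i (x t)) (lam01 t); rewrite -xS.
  have /andP[kl _] := lambda_in t.
  have : kappa * (g / 2) <= lambda t * (`|z - x t| - `|z - T i (x t)|).
    by apply: ler_pM; rewrite ?ltW// divr_gt0.
  lra.
(* There are finitely many indices, so one neighbourhood and one time bound serve them all. *)
have fixes_p : \forall y \near p & t \near \oo, forall i, x t = y ->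
    x t.+1 = (1 - lambda t) *: x t + lambda t *: T i (x t) -> T i p = p.
  by apply: filterS (filter_forall _ fixes_p_i) => -[y t].
have x_cvg : x @ \oo --> p.
  apply: locally_fejer_cvg clp _; apply: filterS fixes_p => -[y t] /= fix_i xty.
  have [_ [i _ <-] /esym xS] := x_step t.
  by apply: (step_le _ i) => //; apply: fix_i.
exists p => //.
have [dl dl0 phi_sub] := A3 p Cp.
have phi_near : \forall t \near \oo, phi (x t) \subset phi p.
  have /cvgrPdist_le/(_ dl dl0) := x_cvg.
  by apply: filterS => t xt; apply: phi_sub.
(* By convergence, [x t] eventually lies in the neighbourhood of [p] from [fixes_p], so the
   condition on [y] disappears. *)
have fix_near : \forall t \near \oo, forall i,
    x t.+1 = (1 - lambda t) *: x t + lambda t *: T i (x t) -> T i p = p.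
  have [[U V] /= [Up Voo] UV] := fixes_p.
  have Ux : \forall t \near \oo, U (x t) by exact: x_cvg.
  by apply: filterS2 Ux Voo => t Uxt Vt i; exact: (UV (x t, t)).
have [t0 _ ht0] := filterI phi_near fix_near.
exists t0 => t /ht0[phi_t fix_t]; split => // i _ xS.
by apply: fix_t => //; rewrite addrC.
Qed.
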